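(* Let $X$ be a completely regular space and let $H$ be a Banach subalgebra of $C_b(X)$ such that (1) for every $x\in X$ there exists some $h\in H$ with $h(x)\neq 0$; (2) for every $f\in C_b(X)$ we have $f\in H$ if $\mathrm{coz}(f)\subseteq\mathrm{coz}(h)$ for some $h\in H$. Then $H$ is isometrically isomorphic to $C_0(Y)$ with the locally compact Hausdorff space $Y$ given by \[Y=\bigcup\big\{\mathrm{int}_{\beta X}\mathrm{cl}_{\beta X}C:C\in\mathrm{Coz}(X)\text{ and }\mathrm{cl}_XC\subseteq\mathrm{coz}(h)\text{ for some }h\in H\big\},\] considered as a subspace of $\beta X$. Furthermore: (a) $X$ is dense in $Y$ (in particular $X\subseteq Y$). (b) $H$ is unital if and only if $H$ contains a non-vanishing element if and only if $Y$ is compact.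
   Context: Completely regular spaces are taken to be Hausdorff, and $\beta X$ is the Stone–Čech compactification of $X$, containing $X$ as a dense subspace. $C_b(X)$ is the normed algebra of continuous bounded $f:X\to\mathbb{R}$ with pointwise operations and the supremum norm; a Banach subalgebra of $C_b(X)$ is a subalgebra that is closed in $C_b(X)$ (not required to contain the constant function $1$). $\mathrm{coz}(f)=X\setminus f^{-1}(0)$, and $\mathrm{Coz}(X)$ is the set of all cozero-sets of continuous real-valued functions on $X$. $C_0(Y)$ is the set of continuous bounded $f:Y\to\mathbb{R}$ with $|f|^{-1}([1/n,\infty))$ compact for each positive integer $n$, with the supremum norm. ''Isometrically isomorphic'' means by an isometric algebra isomorphism. An algebra is unital if it has a multiplicative unit element. An element $h$ is non-vanishing if $h(x)\neq0$ for all $x\in X$. *)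

(* Defs.v *)
From HB Require Import structures.
From mathcomp Require Import all_boot all_order all_algebra.
From mathcomp Require Import all_classical all_reals all_analysis.

Set Implicit Arguments.
Unset Strict Implicit.
Unset Printing Implicit Defensive.

Import Order.TTheory GRing.Theory Num.Theory.
Import numFieldNormedType.Exports.

Local Open Scope classical_set_scope.
Local Open Scope ring_scope.

(* The Stone-Cech compactification is determined up to homeomorphism over X,
   hence a predicate on pairs (bX, e). X is identified with the dense subspace
   range e of bX. *)
Record is_stone_cech (X bX : topologicalType) (e : X -> bX) : Prop := {
  stone_cech_compact : compact [set: bX] ;
  stone_cech_hausdorff : hausdorff_space bX ;
  stone_cech_inj : injective e ;
  stone_cech_embedding : @open X = [set e @^-1` V | V in @open bX] ;
  stone_cech_dense : dense (range e) ;
  stone_cech_extension : forall (K : topologicalType) (g : X -> K),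
    compact [set: K] -> hausdorff_space K -> continuous g ->
    exists2 G : bX -> K, continuous G & forall x, G (e x) = g x
}.

Section Functions.
Context {R : realType}.

Definition coz (X : Type) (f : X -> R) : set X := ~` (f @^-1` [set 0]).

Definition Coz (X : topologicalType) : set (set X) :=
  [set coz f | f in [set f : X -> R | continuous f]].

Definition Cb (X : topologicalType) : set (X -> R) :=
  [set f | continuous f /\ bounded_fun f].

Definition C0 (Y : topologicalType) : set (Y -> R) :=
  [set f | Cb f /\ forall n, (0 < n)%N ->
    compact ((fun y => `|f y|) @^-1` `[n%:R^-1, +oo[)].

(* Also correct for X empty, as sup set0 = 0. *)
Definition supnorm (X : Type) (f : X -> R) : R := sup (range (fun x => `|f x|)).

Record banach_subalgebra (X : topologicalType) (H : set (X -> R)) : Prop := {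
  subalg_Cb : H `<=` @Cb X ;
  subalg_zero : H (fun=> 0) ;
  subalg_add : forall f g, H f -> H g -> H (f \+ g) ;
  subalg_scale : forall (a : R) f, H f -> H (a \*: f) ;
  subalg_mul : forall f g, H f -> H g -> H (f \* g) ;
  subalg_closed : forall f, Cb f ->
    (forall eps : R, 0 < eps -> exists2 h, H h & supnorm (f \- h) < eps) -> H f
}.

(* The zero algebra counts as unital. *)
Definition unital (X : Type) (A : set (X -> R)) : Prop :=
  exists2 u, A u & forall f, A f -> u \* f = f /\ f \* u = f.

(* Phi is total, but only its restriction to A matters. *)
Definition isometrically_isomorphic (X Y : Type)
    (A : set (X -> R)) (B : set (Y -> R)) : Prop :=
  exists Phi : (X -> R) -> (Y -> R),
    [/\ set_bij A B Phi,
        forall f g, A f -> A g -> Phi (f \+ g) = Phi f \+ Phi g,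
        forall (a : R) f, A f -> Phi (a \*: f) = a \*: Phi f,
        forall f g, A f -> A g -> Phi (f \* g) = Phi f \* Phi g
      & forall f, A f -> supnorm (Phi f) = supnorm f].

End Functions.

(* Main.v *)
Require Import Defs.
From HB Require Import structures.
From mathcomp Require Import all_boot all_order all_algebra.
From mathcomp Require Import all_classical all_reals all_analysis.

Set Implicit Arguments.
Unset Strict Implicit.
Unset Printing Implicit Defensive.

Import Order.TTheory GRing.Theory Num.Theory.
Import numFieldNormedType.Exports.

Local Open Scope classical_set_scope.
Local Open Scope ring_scope.

(** The isomorphism sends [h] in [H] to the restriction to [Y] of its continuous
extension [beta_extension e h] to the Stone-Cech compactification. Since [X] is
dense in [Y], this restriction is the only continuous function on [Y] extending
[h] ([gelfand_unique]); uniqueness makes the map compatible with the algebra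
operations, and density makes it isometric ([dense_supnorm]). It is injective,
as restricting to [X] gives [h] back. Two facts show that its image is exactly
[C0 Y].

If [h] is in [H] and [c > 0], the set where the extension of [h] has modulus at
least [c] lies in [Y] ([superlevel_sub_spectrum]): take for [C] the cozero-set
where [|h| > c / 2]. The closure of [C] avoids the zeros of [h], and by density
the closure of its image contains the open set where the extension has modulus
greater than [c / 2]. Superlevel sets are closed in a compact space, so the
extension of [h] vanishes at infinity on [Y]. As every point of [X] lies in such
a superlevel set, also [X] is contained in [Y].

Conversely, a compact subset [K] of [Y] is covered by finitely many of the open
sets defining [Y], whose traces on [X] lie in cozero-sets of elements of [H].
Finite unions of these are again cozero-sets of elements of [H], because
[coz (h1 ^ 2 + h2 ^ 2)] is the union of [coz h1] and [coz h2]; so the trace of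
[K] lies in a single [coz h] ([compact_sub_spectrum_coz]). For [g] in [C0 Y],
truncating the restriction of [g] to [X] at level [c] changes it by at most [c]
and gives a function whose cozero-set lies in the trace of a compact subset of
[Y], hence a function in [H]; as [H] is closed, the restriction of [g] is in
[H] ([mem_of_superlevel_coz], [C0_to_spectrum]).

For the last claim, a unit of [H] is the constant [1], which belongs to [H] as
soon as [H] has a non-vanishing element. If [1] is in [H] then [Y] is a
superlevel set of a function in [C0 Y], hence compact; if [Y] is compact, the
covering argument with [K = Y] produces a non-vanishing element. *)

(** * Continuous real functions *)

Lemma bounded_funP (R : realType) (T : Type) (f : T -> R) :
  bounded_fun f <-> exists M, forall x, `|f x| <= M.
Proof.
split=> [[M [_ Mf]]|[M Mf]].
  by exists (M + 1) => x; apply: Mf => //; rewrite ltrDl.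
exists M; split; first exact: num_real.
by move=> N MN x _; exact: le_trans (Mf x) (ltW MN).
Qed.

Section RealFunctions.
Context {R : realType} {T : topologicalType}.
Implicit Types f g : T -> R.

Lemma continuous_sub f g :
  continuous f -> continuous g -> continuous (fun x => f x - g x).
Proof. by move=> cf cg x; apply: cvgB; [exact: cf|exact: cg]. Qed.

Lemma continuous_normr f : continuous f -> continuous (fun x => `|f x|).
Proof. by move=> cf x; apply: cvg_norm; exact: cf. Qed.

Lemma continuous_maxr f g :
  continuous f -> continuous g -> continuous (fun x => Num.max (f x) (g x)).
Proof. by move=> cf cg x; apply: continuous_max; [exact: cf|exact: cg]. Qed.

Lemma continuous_minr f g :
  continuous f -> continuous g -> continuous (fun x => Num.min (f x) (g x)).
Proof. by move=> cf cg x; apply: continuous_min; [exact: cf|exact: cg]. Qed.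

Lemma continuous_cstr (c : R) : continuous (fun _ : T => c).
Proof. by move=> x; exact: cvg_cst. Qed.

Lemma open_gtr f c : continuous f -> open [set x | c < f x].
Proof.
by move=> cf; apply: (open_comp (D := [set y | c < y])) => //; exact: open_gt.
Qed.

Lemma closed_ger f c : continuous f -> closed [set x | c <= f x].
Proof.
by move=> cf; apply: (closed_comp (D := [set y | c <= y])) => //; exact: closed_ge.
Qed.

Lemma dense_ler f c (D : set T) : continuous f -> dense D ->
  (forall x, D x -> f x <= c) -> forall x, f x <= c.
Proof.
move=> cf dD fDc x; rewrite leNgt; apply/negP => cfx.
have [y [cfy Dy]] := dD _ (ex_intro _ x cfx) (open_gtr c cf).
by move: (fDc _ Dy); rewrite leNgt cfy.
Qed.

Lemma dense_eqr f g (D : set T) : continuous f -> continuous g -> dense D ->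
  (forall x, D x -> f x = g x) -> f = g.
Proof.
move=> cf cg dD fg; apply/funext => x; apply/eqP; rewrite -subr_eq0 -normr_le0.
apply: (@dense_ler (fun x => `|f x - g x|) _ D) => //.
  exact/continuous_normr/continuous_sub.
by move=> y Dy; rewrite fg// subrr normr0.
Qed.

Lemma dense_supnorm (S : Type) (i : S -> T) f :
  continuous f -> bounded_fun f -> dense (range i) ->
  supnorm f = supnorm (f \o i).
Proof.
move=> cf /bounded_funP[M fM] di.
have ubf : has_ubound (range (fun x => `|f x|)).
  by exists M => _ [x _ <-]; exact: fM.
have ubi : has_ubound (range (fun s => `|(f \o i) s|)).
  by exists M => _ [x _ <-]; exact: fM.
(* If [T] is empty, so is [S], and both suprema are those of the empty set. *)
have [[t _]|/set0P/negP/negPn/eqP T0] := pselect ([set: T] !=set0); last first.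
  have S0 : [set: S] = set0.
    rewrite -subset0 => s _; suff : (set0 : set T) (i s) by [].
    by rewrite -T0.
  by rewrite /supnorm T0 S0 !image_set0.
have [_ [_ [s _ _]]] := di setT (ex_intro _ t I) openT.
apply/eqP; rewrite eq_le; apply/andP; split.
  apply: ge_sup; first by exists `|f t|, t.
  move=> _ [x _ <-]; apply: (dense_ler (continuous_normr cf) di) => _ [r _ <-].
  by apply: ub_le_sup => //; exists r.
apply: ge_sup; first by exists `|f (i s)|, s.
by move=> _ [r _ <-]; apply: ub_le_sup => //; exists (i r).
Qed.

End RealFunctions.

(** * Subspaces as types *)

Section Subspaces.
Context {T : topologicalType} (A : set T).

Lemma set_val_hausdorff : hausdorff_space T -> hausdorff_space A.
Proof.
move=> hT x y xy; apply/val_inj/hT => B C Bx Cy.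
have [z [Bz Cz]] := xy _ _ (@initial_continuous A T set_val x _ Bx)
  (@initial_continuous A T set_val y _ Cy).
by exists (set_val z).
Qed.

(** A filter on the subtype is pushed forward to [T], where it clusters at a
point of [K]; open sets of the subtype being traces of open sets of [T], it also
clusters at that point in the subtype. *)
Lemma compact_set_val_preimage (K : set T) :
  K `<=` A -> compact K -> compact (set_val @^-1` K : set A).
Proof.
move=> KA cK F FF FK.
have [|p [Kp Fp]] := cK (set_val @ F) _.
  by apply: filterS FK => x.
have Ap : A p by exact: KA.
exists (exist _ p (mem_set Ap)); split => //.
move=> B C FB [_ [[V oV <-] Vp] VC].
have FB' : F (set_val @^-1` (set_val @` B)).
  by apply: filterS FB => x Bx; exists x.
have [z [[x Bx <-] Vx]] := Fp _ V FB' (open_nbhs_nbhs (conj oV Vp)).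
by exists x; split => //; exact: VC.
Qed.

Lemma compact_set_val_image (K : set A) : compact K -> compact (set_val @` K).
Proof.
apply: continuous_compact; apply: continuous_subspaceT.
exact: initial_continuous.
Qed.

Lemma dense_open_subspace (D : set T) : open A -> dense D ->
  dense [set y : A | D (set_val y)].
Proof.
move=> oA dD O [y Oy] [V oV VO]; rewrite -VO in Oy *.
have [|z [[Vz Az] Dz]] := dD (V `&` A) _ (openI oV oA).
  by exists (set_val y); split => //; exact: set_valP.
by exists (exist _ z (mem_set Az)).
Qed.

(** In a compact Hausdorff space every neighbourhood of a point contains a
closed, hence compact, one. *)
Lemma open_locally_compact : compact [set: T] -> hausdorff_space T -> open A ->
  locally_compact [set: A].
Proof.
move=> cT hT oA y _.
have nA : nbhs (set_val y) A.
  by apply: open_nbhs_nbhs; split => //; exact: set_valP.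
have [B nB BA] := @compact_regular _ (set_val y) setT hT cT filterT A nA.
have cval : continuous (set_val : A -> T) by exact: initial_continuous.
exists (set_val @^-1` closure B : set A).
  have nB' : nbhs y (set_val @^-1` B) := cval y _ nB.
  by apply: filterS nB' => x Bx _; exact: subset_closure.
split; last by apply: (closed_comp (fun x _ => cval x)); exact: closed_closure.
apply: compact_set_val_preimage => //.
by apply: subclosed_compact cT _ => //; exact: closed_closure.
Qed.

End Subspaces.

(** * Extension to the Stone-Cech compactification *)

Section StoneCechExtension.
Context {R : realType} {X bX : topologicalType} {e : X -> bX}.
Hypothesis sc : is_stone_cech e.

Lemma stone_cech_continuous : continuous e.
Proof.
apply/continuousP => V oV.
by rewrite (stone_cech_embedding sc); exists V.
Qed.

Lemma closure_stone_cech_image (C : set X) :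
  e @^-1` closure (e @` C) `<=` closure C.
Proof.
move=> x clx U /=; rewrite nbhsE => -[U' [oU' U'x] U'U].
move: oU'; rewrite (stone_cech_embedding sc) => -[V oV VU'].
have Vx : nbhs (e x) V.
  by apply: open_nbhs_nbhs; split => //; move: U'x; rewrite -VU'.
have [_ [[c Cc <-] Vc]] := clx _ Vx.
by exists c; split => //; apply: U'U; rewrite -VU'.
Qed.

Lemma open_sub_closure_trace (V : set bX) :
  open V -> V `<=` closure (e @` (e @^-1` V)).
Proof.
move=> oV z Vz W /=; rewrite nbhsE => -[W' [oW' W'z] W'W].
have [|_ [/[swap] -[x _ <-] [Vx W'x]]] := stone_cech_dense sc _ (openI oV oW').
  by exists z.
exists (e x); split; last exact: W'W.
by exists x.
Qed.

(** The universal property concerns compact targets: a bounded function is seen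
as taking its values in a segment. *)
Lemma stone_cech_extend (f : X -> R) : Cb f ->
  exists2 G : bX -> R, continuous G & forall x, G (e x) = f x.
Proof.
move=> [cf /bounded_funP[M fM]].
have fI x : f x \in (`[- M, M]%classic : set R).
  by rewrite inE/= in_itv/= -ler_norml.
pose I : set R := `[- M, M]%classic.
have cI : continuous (set_val : I -> R) by exact: initial_continuous.
have [|||G cG Ge] := @stone_cech_extension _ _ _ sc I (fun x => exist _ (f x) (fI x)).
- have := compact_set_val_preimage (@subset_refl _ I) (@segment_compact R (- M) M).
  by congr compact; apply/seteqP; split => // x _; exact: set_valP.
- exact/set_val_hausdorff/Rhausdorff.
- apply/continuousP => _ [V oV <-].
  by move/continuousP : cf => /(_ _ oV).
exists (set_val \o G); last by move=> x /=; rewrite Ge.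
by move=> z; apply: continuous_comp; [exact: cG|exact: cI].
Qed.

Definition beta_extension (f : X -> R) : bX -> R :=
  xget (fun=> 0) [set G | continuous G /\ forall x, G (e x) = f x].

Lemma beta_extensionP f : Cb f ->
  continuous (beta_extension f) /\ forall x, beta_extension f (e x) = f x.
Proof.
move=> /stone_cech_extend[G cG Ge].
by apply: (@xgetPex _ (fun=> 0)
  [set G | continuous G /\ forall x, G (e x) = f x]); exists G.
Qed.

Lemma beta_extension_bounded f : Cb f -> bounded_fun (beta_extension f).
Proof.
move=> Cf; have [_ /bounded_funP[M fM]] := Cf.
have [cG Ge] := beta_extensionP Cf.
apply/bounded_funP; exists M.
apply: (dense_ler (continuous_normr cG) (stone_cech_dense sc)) => _ [x _ <-].
by rewrite Ge.
Qed.

End StoneCechExtension.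

Arguments beta_extension {R X bX} e f z.

(** * The spectrum of an algebra of functions *)

(** The space [Y] of the theorem; the name is justified by
[gelfand_isometric_isomorphism], which makes [Y] the character space of [H]. *)
Definition spectrum {R : realType} {X bX : topologicalType} (e : X -> bX)
    (H : set (X -> R)) : set bX :=
  \bigcup_(C in [set C | @Coz R X C /\ exists2 h, H h & closure C `<=` coz h])
    (closure (e @` C))°.

Section Spectrum.
Context {R : realType} {X bX : topologicalType} {e : X -> bX}.
Context {H : set (X -> R)}.
Hypothesis sc : is_stone_cech e.
Hypothesis algH : banach_subalgebra H.
Hypothesis nzH : forall x, exists2 h, H h & h x != 0.
Hypothesis idealH :
  forall f, Cb f -> (exists2 h, H h & coz f `<=` coz h) -> H f.

Local Notation Y := (spectrum e H).

Lemma open_spectrum : open Y.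
Proof. by apply: bigcup_open => C _; exact: open_interior. Qed.

(** The witness is the cozero-set [C] where [|h| > c / 2]: its closure stays in
the region [|h| >= c / 2], so misses the zeros of [h]. *)
Lemma superlevel_sub_spectrum h c : H h -> 0 < c ->
  [set z | c <= `|beta_extension e h z|] `<=` Y.
Proof.
move=> Hh c0 z cz; have [cG Ge] := beta_extensionP sc (subalg_Cb algH Hh).
have [ch _] := subalg_Cb algH Hh.
have c20 : 0 < c / 2 by rewrite divr_gt0.
set V := [set z | c / 2 < `|beta_extension e h z|].
have oV : open V by exact/open_gtr/continuous_normr.
have VC : e @^-1` V = [set x | c / 2 < `|h x|].
  by apply/seteqP; split => x; rewrite /V/= Ge.
exists [set x | c / 2 < `|h x|]; last first.
  rewrite -VC /interior; apply: filterS (open_sub_closure_trace sc oV) _.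
  apply: open_nbhs_nbhs; split => //.
  by apply: lt_le_trans cz; rewrite ltr_pdivrMr// ltr_pMr// ltr1n.
split.
  exists (fun x => Num.max (`|h x| - c / 2) 0) => /=.
    apply: continuous_maxr; last exact: continuous_cstr.
    by apply: continuous_sub; [exact: continuous_normr|exact: continuous_cstr].
  apply/seteqP; split => x; rewrite /coz/=.
    move=> /eqP; apply: contra_neqT; rewrite -leNgt => hx.
    by apply/max_idPr; rewrite subr_le0.
  by move=> hx; apply/eqP; rewrite gt_eqF// lt_max subr_gt0 hx.
exists h => // x clx.
suff : c / 2 <= `|h x|.
  by move=> hx hx0; move: hx; rewrite hx0 normr0 leNgt c20.
apply: (closed_ger (c := c / 2) (continuous_normr ch)).
by apply: closureS clx => y /ltW.
Qed.

Lemma range_sub_spectrum : range e `<=` Y.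
Proof.
move=> _ [x _ <-]; have [h Hh hx] := nzH x.
apply: (@superlevel_sub_spectrum h `|h x|) => //; first by rewrite normr_gt0.
by have [_ /= ->] := beta_extensionP sc (subalg_Cb algH Hh).
Qed.

Definition to_spectrum (x : X) : Y :=
  exist _ (e x) (mem_set (range_sub_spectrum (imageT e x))).

Lemma to_spectrum_continuous : continuous to_spectrum.
Proof.
apply/continuousP => _ [V oV <-].
by have /continuousP/(_ _ oV) := stone_cech_continuous sc.
Qed.

Lemma range_to_spectrum :
  range to_spectrum = [set y : Y | range e (set_val y)].
Proof.
apply/seteqP; split => [_ [x _ <-]|y [x _ xy]]; first by exists x.
by exists x => //; exact: val_inj.
Qed.

Lemma dense_to_spectrum : dense (range to_spectrum).
Proof.
rewrite range_to_spectrum.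
exact: dense_open_subspace open_spectrum (stone_cech_dense sc).
Qed.

(** The witness is [h1 ^ 2 + h2 ^ 2], the squares preventing cancellation. *)
Lemma coz_directed h1 h2 : H h1 -> H h2 ->
  exists2 h, H h & coz h1 `|` coz h2 `<=` coz h.
Proof.
move=> H1 H2; exists ((h1 \* h1) \+ (h2 \* h2)).
  by apply: subalg_add => //; exact: subalg_mul.
move=> x h12 /eqP/=; rewrite -!expr2 paddr_eq0 ?sqr_ge0// !sqrf_eq0.
by case: h12 => hx /andP[/eqP h1x /eqP h2x]; exact: hx.
Qed.

(** Compactness as a near covering, for the filter on [H] of all [h'] whose
cozero-set is large enough: it is a filter because cozero-sets are directed, and
near each point of the spectrum the trace on [X] is contained in
one [coz h], hence eventually in [coz h']. *)
Lemma compact_sub_spectrum_coz (K : set bX) : compact K -> K `<=` Y ->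
  exists2 h, H h & e @^-1` K `<=` coz h.
Proof.
move=> /compact_near_coveringP cK KY.
pose F : set_system (X -> R) :=
  filter_from H (fun h => [set h' | H h' /\ coz h `<=` coz h']).
have FF : Filter F.
  apply: filter_from_filter; first by exists (fun=> 0); exact: subalg_zero.
  move=> h1 h2 H1 H2; have [h Hh h12] := coz_directed H1 H2.
  exists h => // h' [Hh' hh']; split; split => // x hx; apply/hh'/h12.
    by left.
  by right.
have [] := cK _ F (fun h z => forall x, e x = z -> coz h x) FF.
  move=> z /KY[C [_ [h Hh Ch]] Cz].
  exists ((closure (e @` C))°, [set h' | H h' /\ coz h `<=` coz h']) => /=.
    split; last by exists h.
    by apply: open_nbhs_nbhs; split => //; exact: open_interior.
  move=> [z' h'] /= [Cz' [_ hh']] x xE; apply/hh'/Ch/(closure_stone_cech_image sc).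
  by move/interior_subset: Cz'; rewrite -xE.
move=> h Hh hF; exists h => // x Kx.
exact: (hF h (conj Hh (@subset_refl _ _)) (e x) Kx x erefl).
Qed.

(** The function [f] is a uniform limit of the functions [f - t], where [t] is
[f] clipped to the segment from [- c] to [c]; each vanishes where [|f| < c] and
so belongs to [H] by the ideal property. *)
Lemma mem_of_superlevel_coz f : Cb f ->
  (forall c, 0 < c -> exists2 h, H h & [set x | c <= `|f x|] `<=` coz h) ->
  H f.
Proof.
move=> [cf bf] fh; apply: (Defs.subalg_closed algH (conj cf bf)) => eps eps0.
have [M fM] := (bounded_funP f).1 bf.
pose c := eps / 2; have c0 : 0 < c by rewrite divr_gt0.
pose t x := Num.max (- c) (Num.min (f x) c).
have tc x : `|t x| <= c.
  rewrite ler_norml le_max lexx/= ge_max ge_min lexx orbT andbT.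
  by rewrite (le_trans _ (ltW c0))// oppr_le0 ltW.
have ct : continuous t.
  apply: continuous_maxr; first exact: continuous_cstr.
  by apply: continuous_minr => //; exact: continuous_cstr.
exists (fun x => f x - t x).
  apply: idealH; last first.
    have [h Hh hc] := fh _ c0; exists h => // x ftx; apply: hc => /=.
    rewrite leNgt; apply/negP => fc; apply: ftx => /=.
    move: fc; rewrite ltr_norml => /andP[cfx fxc].
    by rewrite /t (min_idPl (ltW fxc)) (max_idPr (ltW cfx)) subrr.
  split; first exact: continuous_sub.
  apply/bounded_funP; exists (M + c) => x.
  by apply: (le_trans (ler_normB _ _)); exact: lerD.
have cE : c < eps by rewrite /c ltr_pdivrMr// ltr_pMr// ltr1n.
apply: le_lt_trans cE; rewrite /supnorm.
have [X0|/set0P/negP/negPn/eqP X0] := pselect ([set: X] !=set0); last first.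
  by rewrite X0 image_set0 sup0 ltW.
apply: ge_sup; first by case: X0 => x _; eexists; exists x.
by move=> _ [x _ <-]; rewrite /= opprB addrC subrK.
Qed.

(** * The Gelfand transform *)

Definition gelfand (f : X -> R) (y : Y) : R := beta_extension e f (set_val y).

Lemma gelfand_continuous f : Cb f -> continuous (gelfand f).
Proof.
move=> /(beta_extensionP sc)[cG _] y.
by apply: continuous_comp; [exact: initial_continuous|exact: cG].
Qed.

Lemma gelfand_to_spectrum f : Cb f -> gelfand f \o to_spectrum = f.
Proof.
by move=> /(beta_extensionP sc)[_ Ge]; apply/funext => x; exact: Ge.
Qed.

Lemma gelfand_bounded f : Cb f -> bounded_fun (gelfand f).
Proof.
move=> /(beta_extension_bounded sc)/bounded_funP[M fM].
by apply/bounded_funP; exists M => y; exact: fM.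
Qed.

(** Surjectivity and the algebraic identities for [gelfand] are all instances of
this uniqueness, [X] being dense in the spectrum. *)
Lemma gelfand_unique f (g : Y -> R) :
  Cb f -> continuous g -> g \o to_spectrum = f -> gelfand f = g.
Proof.
move=> Cf cg gf.
apply: (dense_eqr (gelfand_continuous Cf) cg dense_to_spectrum) => _ [x _ <-].
rewrite -[gelfand f _]/((gelfand f \o to_spectrum) x) gelfand_to_spectrum//.
by rewrite -gf.
Qed.

Lemma gelfand_C0 h : H h -> C0 (gelfand h).
Proof.
move=> Hh; have Ch := subalg_Cb algH Hh.
split; first by split; [exact: gelfand_continuous|exact: gelfand_bounded].
move=> n n0.
have -> : (fun y => `|gelfand h y|) @^-1` `[n%:R^-1, +oo[%classic =
    set_val @^-1` [set z | n%:R^-1 <= `|beta_extension e h z|] :> set Y.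
  by apply/seteqP; split => y; rewrite /= in_itv/= andbT.
apply: compact_set_val_preimage.
  by apply: superlevel_sub_spectrum => //; rewrite invr_gt0 ltr0n.
apply: subclosed_compact (stone_cech_compact sc) _ => //.
apply/closed_ger/continuous_normr.
by have [] := beta_extensionP sc Ch.
Qed.

Lemma C0_to_spectrum (g : Y -> R) : C0 g -> H (g \o to_spectrum).
Proof.
move=> [[cg /bounded_funP[M gM]] g0]; apply: mem_of_superlevel_coz.
  split; last by apply/bounded_funP; exists M => x; exact: gM.
  by move=> x; apply: continuous_comp; [exact: to_spectrum_continuous|exact: cg].
move=> c c_gt0; pose n := (Num.truncn c^-1).+1.
have nc : n%:R^-1 < c.
  by rewrite invf_plt ?posrE ?ltr0n//; exact: truncnS_gt.
have [|h Hh Kh] := compact_sub_spectrum_coz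
  (compact_set_val_image (g0 n (ltn0Sn _))).
  by move=> _ [y _ <-]; exact: set_valP.
exists h => // x /= cx; apply: Kh; exists (to_spectrum x) => //=.
by rewrite in_itv/= andbT (le_trans (ltW nc)).
Qed.

Lemma gelfand_isometric_isomorphism : isometrically_isomorphic H (@C0 R Y).
Proof.
have HC f : H f -> Cb f by exact: subalg_Cb.
have gelfE f x : H f -> gelfand f (to_spectrum x) = f x.
  by move=> /HC/gelfand_to_spectrum Gf; rewrite -[RHS](congr1 (@^~ x) Gf).
have cG f : H f -> continuous (gelfand f) by move=> /HC/gelfand_continuous.
exists gelfand; split.
- split=> [h|f g /set_mem Hf /set_mem Hg fg|g Cg]; first exact: gelfand_C0.
    rewrite -(gelfand_to_spectrum (HC _ Hf)) fg.
    by rewrite gelfand_to_spectrum//; exact: HC.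
  exists (g \o to_spectrum); first exact: C0_to_spectrum.
  apply: gelfand_unique => //; first exact/HC/C0_to_spectrum.
  by case: Cg => -[].
- move=> f g Hf Hg; apply: gelfand_unique; first exact/HC/(subalg_add algH).
    move=> y; exact: (cvgD (cG _ Hf y)
      (cG _ Hg y)).
  by apply/funext => x /=; rewrite /GRing.add/= !gelfE.
- move=> a f Hf; apply: gelfand_unique; first exact/HC/(subalg_scale algH).
    move=> y; exact: (cvgZr (cG _ Hf y)).
  by apply/funext => x /=; rewrite gelfE.
- move=> f g Hf Hg; apply: gelfand_unique; first exact/HC/(subalg_mul algH).
    move=> y; exact: (cvgM (cG _ Hf y)
      (cG _ Hg y)).
  by apply/funext => x /=; rewrite /GRing.mul/= !gelfE.
- move=> f /HC Cf; rewrite (dense_supnorm _ _ dense_to_spectrum).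
  + by rewrite gelfand_to_spectrum.
  + exact: gelfand_continuous.
  + exact: gelfand_bounded.
Qed.

(** * Units and compactness *)

Lemma unital_nonvanishing : unital H <-> exists2 h, H h & forall x, h x != 0.
Proof.
split=> [[u Hu uH]|[h Hh h0]].
  exists u => // x; have [h Hh hx] := nzH x.
  have [/(congr1 (@^~ x))/= uh _] := uH h Hh.
  by apply: contra_neq hx => ux; rewrite -uh ux mul0r.
exists (fun=> 1); last first.
  by move=> f _; split; apply/funext => x /=; rewrite ?mul1r ?mulr1.
apply: idealH; last by exists h => // x _; exact/eqP/h0.
split; first exact: continuous_cstr.
by apply/bounded_funP; exists 1 => x; rewrite normr1.
Qed.

Lemma nonvanishing_compact_spectrum :
  (exists2 h, H h & forall x, h x != 0) <-> compact [set: Y].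
Proof.
split=> [/unital_nonvanishing[u Hu uH]|cY].
  have u1 : u = fun=> 1.
    apply/funext => x; have [h Hh hx] := nzH x.
    have [/(congr1 (@^~ x))/= uh _] := uH h Hh.
    by apply: (mulIf hx); rewrite mul1r.
  have Gu : gelfand u = fun=> 1.
    apply: gelfand_unique; first exact: subalg_Cb Hu.
      exact: continuous_cstr.
    by rewrite u1.
  have [_ /(_ 1 isT)] := gelfand_C0 Hu.
  congr compact; apply/seteqP; split => // y _.
  by rewrite /= Gu in_itv/= normr1 invr1 lexx.
have [|h Hh Yh] := compact_sub_spectrum_coz (compact_set_val_image cY).
  by move=> _ [y _ <-]; exact: set_valP.
exists h => // x; apply/eqP/Yh.
by exists (to_spectrum x).
Qed.

End Spectrum.

Theorem theorem5p2 (R : realType) (X bX : topologicalType) (e : X -> bX)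
    (H : set (X -> R)) :
  completely_regular_space X -> hausdorff_space X ->
  is_stone_cech e ->
  banach_subalgebra H ->
  (forall x, exists2 h, H h & h x != 0) ->
  (forall f, Cb f -> (exists2 h, H h & coz f `<=` coz h) -> H f) ->
  let Y : set bX :=
    \bigcup_(C in [set C | @Coz R X C /\ exists2 h, H h & closure C `<=` coz h])
      (closure (e @` C))° in
  [/\ locally_compact [set: Y],
      hausdorff_space Y,
      isometrically_isomorphic H (@C0 R Y),
      range e `<=` Y /\ dense [set y : Y | range e (set_val y)]
    & (unital H <-> exists2 h, H h & forall x, h x != 0) /\
      ((exists2 h, H h & forall x, h x != 0) <-> compact [set: Y])].
Proof.
move=> _ _ sc algH nzH idealH Y; split.
- exact: open_locally_compact (stone_cech_compact sc)
    (stone_cech_hausdorff sc) (open_spectrum).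
- exact: set_val_hausdorff (stone_cech_hausdorff sc).
- exact: gelfand_isometric_isomorphism.
- split; first exact: range_sub_spectrum.
  exact: dense_open_subspace open_spectrum (stone_cech_dense sc).
- split; first exact: unital_nonvanishing.
  exact: nonvanishing_compact_spectrum.
Qed.
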